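(* Let $p,q\ge2$ and let $AG(p-1,p+q-1)$ be an almost Grassmann structure on a manifold of dimension $pq$. Let $u^{i\beta\gamma}_{\alpha jk}=-u^{i\gamma\beta}_{\alpha kj}$ be the quantities occurring in the structure equations $$d\omega_\alpha^i=\omega_\alpha^\beta\wedge\omega_\beta^i+\omega_\alpha^j\wedge\omega_j^i+\omega\wedge\omega_\alpha^i+u^{i\beta\gamma}_{\alpha jk}\,\omega_\beta^j\wedge\omega_\gamma^k,\qquad \omega_\gamma^\gamma=0,\ \omega_k^k=0,$$ in a general (not specialized) second-order frame, and set $$u^{\beta\gamma}_{\alpha k}=u^{i\beta\gamma}_{\alpha ik},\qquad u^{i\gamma}_{jk}=u^{i\alpha\gamma}_{\alpha jk},\qquad u^\gamma_k=u^{l\gamma}_{lk},\qquad \widetilde u^\gamma_k=u^{l\gamma}_{kl},$$ $$x^{i\beta\gamma}_{\alpha jk}=-\tfrac{1}{q^2-1}\Bigl[q\bigl(\delta^i_ju^{\beta\gamma}_{\alpha k}-\delta^i_ku^{\gamma\beta}_{\alpha j}\bigr)+\delta^i_ju^{\gamma\beta}_{\alpha k}-\delta^i_ku^{\beta\gamma}_{\alpha j}\Bigr],$$ $$y^{i\beta\gamma}_{\alpha jk}=-\tfrac{1}{p^2-1}\Bigl[p\bigl(\delta^\beta_\alpha u^{i\gamma}_{jk}-\delta^\gamma_\alpha u^{i\beta}_{kj}\bigr)+\delta^\beta_\alpha u^{i\gamma}_{kj}-\delta^\gamma_\alpha u^{i\beta}_{jk}\Bigr],$$ $$z^{i\beta\gamma}_{\alpha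 jk}=\tfrac{1}{(p^2-1)(q^2-1)}\Bigl[(pq-1)\bigl(\delta^i_j\delta^\beta_\alpha u^\gamma_k-\delta^i_k\delta^\gamma_\alpha u^\beta_j+\delta^i_k\delta^\beta_\alpha\widetilde u^\gamma_j-\delta^i_j\delta^\gamma_\alpha\widetilde u^\beta_k\bigr)+(q-p)\bigl(\delta^i_j\delta^\beta_\alpha\widetilde u^\gamma_k-\delta^i_k\delta^\gamma_\alpha\widetilde u^\beta_j+\delta^i_k\delta^\beta_\alpha u^\gamma_j-\delta^i_j\delta^\gamma_\alpha u^\beta_k\bigr)\Bigr].$$ Then the relative tensor $\widetilde a=\{\widetilde a^{i\beta\gamma}_{\alpha jk}\}$ defined by $$\widetilde a^{i\beta\gamma}_{\alpha jk}=u^{i\beta\gamma}_{\alpha jk}+x^{i\beta\gamma}_{\alpha jk}+y^{i\beta\gamma}_{\alpha jk}+z^{i\beta\gamma}_{\alpha jk},$$ which satisfies $\widetilde a^{i\alpha\gamma}_{\alpha jk}=0$, $\widetilde a^{i\beta\gamma}_{\alpha ik}=0$, $\widetilde a^{i\beta\gamma}_{\alpha jk}=-\widetilde a^{i\gamma\beta}_{\alpha kj}$, coincides with the torsion tensor $a=\{a^{i\beta\gamma}_{\alpha jk}\}$ of the structure: $\widetilde a=a$.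
   Context: Index ranges: $\alpha,\beta,\ldots=1,\dots,p$; $i,j,\ldots=p+1,\dots,p+q$; summation over repeated indices; everything real and smooth. Almost Grassmann structure: for $\dim M=pq$, an almost Grassmann structure $AG(p-1,p+q-1)$ is a smooth field of Segre cones $SC_x(p,q)\subset T_x(M)$. That is, locally there are smooth (adapted) frames $\{e_i^\alpha\}$ with dual coframe $\omega_\alpha^i$ such that $SC_x(p,q)=\{z=z^i_\alpha e_i^\alpha:\ z^i_\alpha=t_\alpha s^i\text{ for some }t_\alpha,s^i\}$. Adapted frames are related by $'e_i^\alpha=A_\beta^\alpha A_i^je_j^\beta$ with nonsingular matrices. Second-order frames: for adapted coframes $\omega_\alpha^i$ there exist 1-forms $\omega_\alpha^\beta$, $\omega_j^i$ (trace-free) and $\omega$ satisfying the structure equations in the claim with some functions $u^{i\beta\gamma}_{\alpha jk}=-u^{i\gamma\beta}_{\alpha kj}$. These fiber forms are not unique: they may be changed by adding combinations of the basis forms $\omega_\alpha^i$, with a corresponding change of $u$. A choice corresponds to a second-order frame. Torsion tensor: second-order frames can be specialized so that $u^{i\beta\gamma}_{\alpha ik}=0$ and $u^{i\alpha\gamma}_{\alpha jk}=0$. The values of $u^{i\beta\gamma}_{\alpha jk}$ in such specialized frames (for the same adapted coframe) are denoted $a^{i\beta\gamma}_{\alpha jk}$ and form the torsion tensor (first structure tensor) of the structure. They are determined by the adapted coframe. *)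

(* Defs.v *)
From HB Require Import structures.
From mathcomp Require Import all_boot all_order all_algebra.
From mathcomp Require Import all_classical all_reals all_analysis.

Set Implicit Arguments.
Unset Strict Implicit.
Unset Printing Implicit Defensive.

Import Order.TTheory GRing.Theory Num.Theory.
Import numFieldNormedType.Exports.

Local Open Scope classical_set_scope.
Local Open Scope ring_scope.

(* Smooth functions on an open subset O of R^n; the values of f outside O are
   irrelevant. *)

Section EuclideanSmoothness.
Variables (R : realType) (n : nat).
Implicit Types (O : set 'rV[R]_n) (f : 'rV[R]_n -> R).

Definition partial (a : 'I_n) f : 'rV[R]_n -> R := 'D_(delta_mx 0 a) f.

Fixpoint Ck_on (k : nat) O f : Prop :=
  (forall y, O y -> {for y, continuous f}) /\
  match k with
  | 0 => True
  | k'.+1 => forall a : 'I_n,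
      (forall y, O y -> derivable f y (delta_mx 0 a)) /\
      Ck_on k' O (partial a f)
  end.

Definition smooth_on O f : Prop := forall k, Ck_on k O f.

End EuclideanSmoothness.

Record smooth_manifold (R : realType) (n : nat) (M : topologicalType) :=
  SmoothManifold {
    chart : Type;
    dom : chart -> set M;
    coord : chart -> M -> 'rV[R]_n;
    param : chart -> 'rV[R]_n -> M;
    manifold_hausdorff : hausdorff_space M;
    manifold_second_countable : @second_countable M;
    dom_open : forall c, open (dom c);
    codom_open : forall c, open (coord c @` dom c);
    coordK : forall c x, dom c x -> param c (coord c x) = x;
    coord_continuous : forall c x, dom c x -> {for x, continuous (coord c)};
    param_continuous : forall c y, (coord c @` dom c) y ->
      {for y, continuous (param c)};
    dom_cover : forall x, exists c, dom c x;
    transition_smooth : forall c c' (a : 'I_n),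
      smooth_on (coord c @` (dom c `&` dom c'))
                (fun y => coord c' (param c y) 0 a)
  }.

Section Calculus.
Variables (R : realType) (n : nat) (M : topologicalType).
Variable S : smooth_manifold R n M.
Implicit Types (c : chart S) (x : M) (U : set M).

(* A tangent vector (covector) at x is the family of its components in all the
   charts around x, transforming with the Jacobian matrices of the coordinate
   changes.  Components in the charts that do not contain x are set to 0, so
   that equality of tangent vectors is equality of families.  The matrix
   jacobian f y acts on row vectors from the right. *)
Definition components : Type := chart S -> 'rV[R]_n.

Definition transition_jacobian c c' x : 'M[R]_n :=
  jacobian (fun y => coord c' (param c y)) (coord c x).

Definition tangent_space x : set components :=
  [set v | (forall c, ~ dom c x -> v c = 0) /\
           (forall c c', dom c x -> dom c' x ->
              v c' = v c *m transition_jacobian c c' x)].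

Definition cotangent_space x : set components :=
  [set w | (forall c, ~ dom c x -> w c = 0) /\
           (forall c c', dom c x -> dom c' x ->
              w c = w c' *m (transition_jacobian c c' x)^T)].

Definition smooth_fun U (f : M -> R) : Prop :=
  forall c, smooth_on (coord c @` (dom c `&` U)) (fun y => f (param c y)).

Definition component c (X : M -> components) (a : 'I_n) : 'rV[R]_n -> R :=
  fun y => X (param c y) c 0 a.

Definition smooth_components U (X : M -> components) : Prop :=
  forall c a, smooth_on (coord c @` (dom c `&` U)) (component c X a).

Definition vector_field U (X : M -> components) : Prop :=
  (forall x, U x -> tangent_space x (X x)) /\ smooth_components U X.

Definition one_form U (w : M -> components) : Prop :=
  (forall x, U x -> cotangent_space x (w x)) /\ smooth_components U w.

Definition pairing c (w v : components) : R := \sum_a w c 0 a * v c 0 a.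

(* 2-forms are handled through their components in a chart c: the entry (a, b)
   is the value on the coordinate vectors (d/dy_a, d/dy_b). *)
Definition ext_d c (w : M -> components) x : 'M[R]_n :=
  \matrix_(a, b) (partial a (component c w b) (coord c x)
                  - partial b (component c w a) (coord c x)).

Definition wedge c (w1 w2 : M -> components) x : 'M[R]_n :=
  \matrix_(a, b) (w1 x c 0 a * w2 x c 0 b - w1 x c 0 b * w2 x c 0 a).

End Calculus.

(* Greek indices live in 'I_p and Latin ones in 'I_q.  A symbol
   u^{i be ga}_{al j k} is written u i be ga al j k. *)

Section TensorAlgebra.
Variables (R : realType) (p q : nat).

Definition tensor : Type :=
  'I_q -> 'I_p -> 'I_p -> 'I_p -> 'I_q -> 'I_q -> R.

Implicit Type u : tensor.

Definition antisymmetric_tensor u : Prop :=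
  forall i be ga al j k, u i be ga al j k = - u i ga be al k j.

Definition trace_free u : Prop :=
  (forall be ga al k, \sum_(i < q) u i be ga al i k = 0) /\
  (forall i ga j k, \sum_(al < p) u i al ga al j k = 0).

(* u^{be ga}_{al k}, u^{i ga}_{j k}, u^ga_k and \tilde u^ga_k *)
Definition trace_q u (be ga al : 'I_p) (k : 'I_q) : R :=
  \sum_(i < q) u i be ga al i k.

Definition trace_p u (i : 'I_q) (ga : 'I_p) (j k : 'I_q) : R :=
  \sum_(al < p) u i al ga al j k.

Definition trace_pq u (ga : 'I_p) (k : 'I_q) : R :=
  \sum_(l < q) trace_p u l ga l k.

Definition trace_pq' u (ga : 'I_p) (k : 'I_q) : R :=
  \sum_(l < q) trace_p u l ga k l.

Definition delta m (a b : 'I_m) : R := (a == b)%:R.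

Definition x_tensor u : tensor := fun i be ga al j k =>
  - (q%:R ^+ 2 - 1)^-1 *
  (q%:R * (delta i j * trace_q u be ga al k - delta i k * trace_q u ga be al j)
   + delta i j * trace_q u ga be al k - delta i k * trace_q u be ga al j).

Definition y_tensor u : tensor := fun i be ga al j k =>
  - (p%:R ^+ 2 - 1)^-1 *
  (p%:R * (delta be al * trace_p u i ga j k - delta ga al * trace_p u i be k j)
   + delta be al * trace_p u i ga k j - delta ga al * trace_p u i be j k).

Definition z_tensor u : tensor := fun i be ga al j k =>
  ((p%:R ^+ 2 - 1) * (q%:R ^+ 2 - 1))^-1 *
  ((p%:R * q%:R - 1) *
     (delta i j * delta be al * trace_pq u ga k
      - delta i k * delta ga al * trace_pq u be j
      + delta i k * delta be al * trace_pq' u ga j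
      - delta i j * delta ga al * trace_pq' u be k)
   + (q%:R - p%:R) *
     (delta i j * delta be al * trace_pq' u ga k
      - delta i k * delta ga al * trace_pq' u be j
      + delta i k * delta be al * trace_pq u ga j
      - delta i j * delta ga al * trace_pq u be k)).

Definition a_tilde u : tensor := fun i be ga al j k =>
  u i be ga al j k + x_tensor u i be ga al j k + y_tensor u i be ga al j k
  + z_tensor u i be ga al j k.

(* Transformation law of the components of the vector-valued 2-form
   a^{i be ga}_{al j k} omega_be^j ^ omega_ga^k (x) e_i^al under the change of
   frame 'e_i^al = P_be^al Q_i^j e_j^be, for which
   omega_de^l = P_de^al Q_i^l 'omega_al^i.  Entries: P be al, Q i j. *)
Definition tensor_law (P : 'M[R]_p) (Q : 'M[R]_q) (a a' : tensor) : Prop :=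
  forall (l : 'I_q) (be ga de : 'I_p) (j k : 'I_q),
    \sum_(al < p) \sum_(i < q) P de al * Q i l * a' i be ga al j k =
    \sum_(be' < p) \sum_(ga' < p) \sum_(j' < q) \sum_(k' < q)
       P be' be * Q j j' * (P ga' ga * Q k k') * a l be' ga' de j' k'.

End TensorAlgebra.

Section AlmostGrassmann.
Variables (R : realType) (p q : nat) (M : topologicalType).
Variable S : smooth_manifold R (p * q) M.

Notation field := (M -> components S).

(* e i al stands for e_i^al and w al i for omega_al^i. *)
Definition dual_coframe (U : set M) (e : 'I_q -> 'I_p -> field)
    (w : 'I_p -> 'I_q -> field) : Prop :=
  forall x (c : chart S), U x -> dom c x -> forall al i j be,
    pairing c (w al i x) (e j be x) = (al == be)%:R * (i == j)%:R.

Definition segre_cone (e : 'I_q -> 'I_p -> field) (x : M) :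
    set (components S) :=
  [set z | exists (t : 'I_p -> R) (s : 'I_q -> R),
     z = fun c => \sum_(al < p) \sum_(i < q) (t al * s i) *: e i al x c].

(* Since the dimension is p q, duality forces the e i al to be a basis. *)
Record adapted_frame (SC : M -> set (components S)) (U : set M)
    (e : 'I_q -> 'I_p -> field) (w : 'I_p -> 'I_q -> field) : Prop :=
  AdaptedFrame {
    adapted_open : open U;
    adapted_vector_field : forall i al, vector_field U (e i al);
    adapted_one_form : forall al i, one_form U (w al i);
    adapted_dual : dual_coframe U e w;
    adapted_cone : forall x, U x -> SC x = segre_cone e x
  }.

Definition almost_grassmann (SC : M -> set (components S)) : Prop :=
  forall x, exists U e w, U x /\ adapted_frame SC U e w.

Definition frame_change (V : set M) (e e' : 'I_q -> 'I_p -> field)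
    (P : M -> 'M[R]_p) (Q : M -> 'M[R]_q) : Prop :=
  [/\ forall be al, smooth_fun S V (fun x => P x be al),
      forall i j, smooth_fun S V (fun x => Q x i j),
      forall x, V x -> P x \in unitmx /\ Q x \in unitmx
    & forall x, V x -> forall i al c,
        e' i al x c =
        \sum_(be < p) \sum_(j < q) (P x be al * Q x i j) *: e j be x c].

(* th al be, ph j i and om stand for omega_al^be, omega_j^i and omega. *)
Record second_order_frame (U : set M) (w : 'I_p -> 'I_q -> field)
    (th : 'I_p -> 'I_p -> field) (ph : 'I_q -> 'I_q -> field) (om : field)
    (u : M -> tensor R p q) : Prop :=
  SecondOrderFrame {
    sof_one_form_th : forall al be, one_form U (th al be);
    sof_one_form_ph : forall j i, one_form U (ph j i);
    sof_one_form_om : one_form U om;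
    sof_trace_th : forall x, U x -> forall c, \sum_(ga < p) th ga ga x c = 0;
    sof_trace_ph : forall x, U x -> forall c, \sum_(k < q) ph k k x c = 0;
    sof_smooth : forall i be ga al j k,
      smooth_fun S U (fun x => u x i be ga al j k);
    sof_antisymmetric : forall x, U x -> antisymmetric_tensor (u x);
    sof_structure : forall x (c : chart S), U x -> dom c x -> forall al i,
      ext_d c (w al i) x =
        \sum_(be < p) wedge c (th al be) (w be i) x
        + \sum_(j < q) wedge c (w al j) (ph j i) x
        + wedge c om (w al i) x
        + \sum_(be < p) \sum_(ga < p) \sum_(j < q) \sum_(k < q)
            u x i be ga al j k *: wedge c (w be j) (w ga k) x
  }.

(* a is the field of components, in the adapted coframe w, of the torsion
   tensor: the values of u in a specialized second-order frame. *)
Definition torsion_tensor (U : set M) (w : 'I_p -> 'I_q -> field)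
    (a : M -> tensor R p q) : Prop :=
  exists th ph om, second_order_frame U w th ph om a /\
    forall x, U x -> trace_free (a x).

End AlmostGrassmann.

(* Main.v *)
Require Import Defs.
From HB Require Import structures.
From mathcomp Require Import all_boot all_order all_algebra.
From mathcomp Require Import all_classical all_reals all_analysis.
From mathcomp Require Import ring lra.

(** Why it is true.  Write a change of the fiber forms th, ph, om by multiples
    of the coframe: its effect on u is to add a tensor of the shape
      delta^i_j F^(be ga)_(al k) + delta^be_al G^(i ga)_(j k),
    antisymmetrized in the pairs (j, be), (k, ga); such a tensor is called a
    [delta_form] below.  Conversely every delta form can be absorbed into the
    fiber forms ([absorb_delta_form]).  The corrections x + y + z are a delta
    form ([a_tildeE]) chosen so that all the traces of a_tilde vanish
    ([a_tilde_trace_free], a direct computation).  Hence a_tilde is the value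
    of u in some specialized frame: it satisfies the definition of the torsion
    tensor ([normalized_second_order_frame]).

    Uniqueness rests on positivity: contracting a trace-free tensor with a
    delta form always produces a trace, so trace-free tensors are orthogonal to
    delta forms for the standard inner product, and a tensor that is both is
    zero ([trace_free_delta_form_eq0]).

    The tensor law comes from the same orthogonality.  Let the coframes be
    related by w = P Q w' and let both second-order frames be specialized.
    Differentiate the relation and evaluate it on two vectors e'_j^be, e'_k^ga.
    All terms other than the torsions contain a connection form or a
    differential dP, dQ multiplied by an entry of Q or P, so that the defect in
    the transformation law is a delta form with delta^i_j, delta^be_al replaced
    by Q_j^l, P_de^be ([structure_comparison]).  Applying P^-1 and Q^-1 to its
    free indices turns it into a genuine delta form which is still trace-free,
    since the trace of a transformed tensor is the transform of its trace; hence
    it vanishes ([tensor_lawP]).  Uniqueness of the torsion tensor is the case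
    P = Q = 1. *)

Set Implicit Arguments.
Unset Strict Implicit.
Unset Printing Implicit Defensive.

Import Order.TTheory GRing.Theory Num.Theory.
Import numFieldNormedType.Exports.

Local Open Scope classical_set_scope.
Local Open Scope ring_scope.

(** * Smooth functions and 1-forms *)

Section SmoothFunctions.
Variables (R : realType) (n : nat).
Implicit Types (O : set 'rV[R]_n) (f g : 'rV[R]_n -> R).

Lemma eq_near_open O f g y : open O -> {in O, f =1 g} -> O y ->
  \forall z \near y, f z = g z.
Proof.
move=> oO fg Oy; have : nbhs y O by exact: open_nbhs_nbhs.
by apply: filterS => z Oz; apply: fg; rewrite inE.
Qed.

Lemma partial_eq O f g a : open O -> {in O, f =1 g} ->
  {in O, partial a f =1 partial a g}.
Proof.
move=> oO fg y; rewrite inE => Oy; apply: near_eq_derive.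
exact: eq_near_open fg Oy.
Qed.

(** Partial derivatives of sums and products are known on the open set only,
    and derivatives are local; this lets the inductions below replace them by
    their formulas there. *)
Lemma Ck_on_ext k O f g : open O -> {in O, f =1 g} -> Ck_on k O f -> Ck_on k O g.
Proof.
move=> oO; elim: k f g => [|k IH] f g fg [cf hf]; split => //.
- move=> y Oy; have e := eq_near_open oO fg Oy.
  rewrite /prop_for /continuous_at -(fg y) ?inE //.
  apply: cvg_trans (cf y Oy); exact: near_eq_cvg e.
- move=> y Oy; have e := eq_near_open oO fg Oy.
  rewrite /prop_for /continuous_at -(fg y) ?inE //.
  apply: cvg_trans (cf y Oy); exact: near_eq_cvg e.
move=> a; have [df hf'] := hf a; split=> [y Oy|].
  by apply: (near_eq_derivable _ (df y Oy)); exact: eq_near_open fg Oy.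
by apply: IH hf'; exact: partial_eq.
Qed.

Lemma Ck_onW k O f : Ck_on k.+1 O f -> Ck_on k O f.
Proof.
elim: k f => [|k IH] f [cf hf]; split=> // a.
by have [df hf'] := hf a; split=> //; exact: IH.
Qed.

Lemma Ck_onD k O f g : open O -> Ck_on k O f -> Ck_on k O g -> Ck_on k O (f \+ g).
Proof.
move=> oO; elim: k f g => [|k IH] f g [cf hf] [cg hg]; split=> //;
  try by move=> y Oy; apply: continuousD; [exact: cf|exact: cg].
move=> a; have [df hf'] := hf a; have [dg hg'] := hg a.
split=> [y Oy|]; first by apply: derivableD; [exact: df|exact: dg].
apply: Ck_on_ext (IH _ _ hf' hg') => // y; rewrite inE => Oy.
by rewrite /= /partial deriveD; [|exact: df|exact: dg].
Qed.

Lemma Ck_onM k O f g : open O -> Ck_on k O f -> Ck_on k O g -> Ck_on k O (f \* g).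
Proof.
move=> oO; elim: k f g => [|k IH] f g Hf Hg; have [cf hf] := Hf;
  have [cg hg] := Hg; split=> //;
  try by move=> y Oy; apply: continuousM; [exact: cf|exact: cg].
move=> a; have [df hf'] := hf a; have [dg hg'] := hg a.
split=> [y Oy|]; first by apply: derivableM; [exact: df|exact: dg].
have H := Ck_onD oO (IH _ _ (Ck_onW Hf) hg') (IH _ _ (Ck_onW Hg) hf').
apply: Ck_on_ext H => // y; rewrite inE => Oy.
by rewrite /= /partial deriveM; [|exact: df|exact: dg].
Qed.

Lemma Ck_on_cst k O (r : R) : open O -> Ck_on k O (fun=> r).
Proof.
move=> oO; elim: k r => [|k IH] r; split=> //;
  try by move=> y Oy; exact: cst_continuous.
move=> a; split=> [y Oy|]; first exact: derivable_cst.
apply: Ck_on_ext (IH 0) => // y _.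
by rewrite /partial (derive_cst r).
Qed.

Lemma smooth_on_derivable O f y a : smooth_on O f -> O y ->
  derivable f y (delta_mx 0 a).
Proof. by move=> /(_ 1)[_ /(_ a)[df _]] /df. Qed.

End SmoothFunctions.

Section SmoothFields.
Variables (R : realType) (n : nat) (M : topologicalType).
Variable S : smooth_manifold R n M.
Implicit Types (c : chart S) (x : M) (U : set M) (f g : M -> R).

(** The inverse chart is only known to be continuous at the points of the open
    set [coord c @` dom c], so openness is checked at each point. *)
Lemma open_chart_image U c : open U -> open (Defs.coord c @` (dom c `&` U)).
Proof.
move=> oU; rewrite openE => _ [x [cx Ux] <-].
have cy : (Defs.coord c @` dom c) (Defs.coord c x) by exists x.
have H1 : \forall y \near Defs.coord c x, (Defs.coord c @` dom c) y.
  by apply: open_nbhs_nbhs; split=> //; exact: codom_open.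
have H2 : \forall y \near Defs.coord c x, U (param c y).
  apply: (param_continuous cy); apply: open_nbhs_nbhs; split=> //.
  by rewrite /= coordK.
rewrite /interior; near=> y.
have [z cz zy] : (Defs.coord c @` dom c) y by near: y.
exists z => //; split=> //.
by rewrite -(coordK cz) zy; near: y.
Unshelve. all: by end_near. Qed.

Lemma smooth_fun_cst U (r : R) : open U -> smooth_fun S U (fun=> r).
Proof. by move=> oU c k; apply: Ck_on_cst; exact: open_chart_image. Qed.

Lemma smooth_funD U f g : open U -> smooth_fun S U f -> smooth_fun S U g ->
  smooth_fun S U (fun x => f x + g x).
Proof.
by move=> oU hf hg c k; apply: Ck_onD; [exact: open_chart_image|exact: hf|exact: hg].
Qed.

Lemma smooth_funM U f g : open U -> smooth_fun S U f -> smooth_fun S U g ->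
  smooth_fun S U (fun x => f x * g x).
Proof.
by move=> oU hf hg c k; apply: Ck_onM; [exact: open_chart_image|exact: hf|exact: hg].
Qed.

Lemma smooth_funB U f g : open U -> smooth_fun S U f -> smooth_fun S U g ->
  smooth_fun S U (fun x => f x - g x).
Proof.
move=> oU hf hg.
have := smooth_funD oU hf (smooth_funM oU (smooth_fun_cst (-1) oU) hg).
by under eq_fun do rewrite mulN1r.
Qed.

Lemma smooth_fun_sum (I : Type) (r : seq I) U (f : I -> M -> R) : open U ->
  (forall i, smooth_fun S U (f i)) -> smooth_fun S U (fun x => \sum_(i <- r) f i x).
Proof.
move=> oU hf; elim: r => [|i r IH].
  have -> : (fun x => \sum_(i <- [::]) f i x) = fun=> 0.
    by apply/funext => x; rewrite big_nil.
  exact: smooth_fun_cst.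
have -> : (fun x => \sum_(j <- i :: r) f j x) = fun x => f i x + \sum_(j <- r) f j x.
  by apply/funext => x; rewrite big_cons.
exact: smooth_funD.
Qed.

Lemma one_formD U (v w : M -> components S) : open U ->
  one_form U v -> one_form U w -> one_form U (fun x c => v x c + w x c).
Proof.
move=> oU [tv sv] [tw sw]; split=> [x Ux|c a k].
  have [v0 vE] := tv x Ux; have [w0 wE] := tw x Ux; split=> [c cx|c c' cx c'x].
    by rewrite v0 // w0 // addr0.
  by rewrite (vE _ _ cx c'x) (wE _ _ cx c'x) mulmxDl.
apply: Ck_on_ext (Ck_onD _ (sv c a k) (sw c a k)); try exact: open_chart_image.
by move=> y _; rewrite /component /= mxE.
Qed.

Lemma one_formZ U f (w : M -> components S) : open U ->
  smooth_fun S U f -> one_form U w -> one_form U (fun x c => f x *: w x c).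
Proof.
move=> oU sf [tw sw]; split=> [x Ux|c a k].
  have [w0 wE] := tw x Ux; split=> [c cx|c c' cx c'x].
    by rewrite w0 // scaler0.
  by rewrite (wE _ _ cx c'x) scalemxAl.
apply: Ck_on_ext (Ck_onM _ (sf c k) (sw c a k)); try exact: open_chart_image.
by move=> y _; rewrite /component /= mxE.
Qed.

Lemma one_form_sum (I : Type) (r : seq I) U (w : I -> M -> components S) :
  open U -> (forall i, one_form U (w i)) ->
  one_form U (fun x c => \sum_(i <- r) w i x c).
Proof.
move=> oU hw; elim: r => [|i r IH].
  have -> : (fun x c => \sum_(i <- [::]) w i x c) = fun _ _ => 0.
    by apply/funext => x; apply/funext => c; rewrite big_nil.
  split=> [x Ux|c a k]; first by split=> // c c' _ _; rewrite mul0mx.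
  apply: Ck_on_ext (Ck_on_cst k 0 _); try exact: open_chart_image.
  by move=> y _; rewrite /component /= mxE.
have -> : (fun x c => \sum_(j <- i :: r) w j x c) =
    fun x c => w i x c + \sum_(j <- r) w j x c.
  by apply/funext => x; apply/funext => c; rewrite big_cons.
exact: one_formD.
Qed.

End SmoothFields.

(** * Delta forms and trace-free tensors *)

Section Sums.
Variable R : realType.

Lemma sum_deltal m (i : 'I_m) (f : 'I_m -> R) : \sum_j delta R i j * f j = f i.
Proof.
rewrite (bigD1 i) //= big1 /delta ?eqxx ?mul1r ?addr0 // => j /negPf.
by rewrite eq_sym => ->; rewrite mul0r.
Qed.

Lemma exchange_big13 (I J K L : finType) (f : I -> J -> K -> L -> R) :
  \sum_i \sum_j \sum_k \sum_l f i j k l = \sum_j \sum_k \sum_l \sum_i f i j k l.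
Proof.
rewrite exchange_big; apply: eq_bigr => j _.
by rewrite exchange_big; apply: eq_bigr => k _; exact: exchange_big.
Qed.

Lemma exchange_big33 (I J K I' J' K' : finType)
    (f : I -> J -> K -> I' -> J' -> K' -> R) :
  \sum_i \sum_j \sum_k \sum_i' \sum_j' \sum_k' f i j k i' j' k' =
  \sum_i' \sum_j' \sum_k' \sum_i \sum_j \sum_k f i j k i' j' k'.
Proof.
rewrite -[RHS]exchange_big13; apply: eq_bigr => i _.
rewrite -[RHS]exchange_big13; apply: eq_bigr => j _.
exact: exchange_big13.
Qed.

Lemma psum_eq0 (I : finType) (f : I -> R) :
  (forall i, 0 <= f i) -> \sum_i f i = 0 -> forall i, f i = 0.
Proof.
move=> f0 /eqP; rewrite psumr_eq0 // => /allP h i.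
by have /eqP := h i (mem_index_enum i).
Qed.

Lemma deltaC m (i j : 'I_m) : delta R i j = delta R j i.
Proof. by rewrite /delta eq_sym. Qed.

Lemma sum_deltar m (i : 'I_m) (f : 'I_m -> R) : \sum_j delta R j i * f j = f i.
Proof. by under eq_bigr do rewrite deltaC; exact: sum_deltal. Qed.

Lemma sum_delta m : \sum_(i < m) delta R i i = m%:R.
Proof.
by under eq_bigr do rewrite /delta eqxx; rewrite sumr_const card_ord.
Qed.
End Sums.

Section TraceDecomposition.
Variables (R : realType) (p q : nat).
Implicit Types (u : tensor R p q) (F : 'I_p -> 'I_p -> 'I_p -> 'I_q -> R)
  (G : 'I_q -> 'I_p -> 'I_q -> 'I_q -> R).

(** The change of the torsion functions under a change of the fiber forms. *)
Definition delta_form F G : tensor R p q := fun i be ga al j k =>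
  delta R i j * F be ga al k - delta R i k * F ga be al j
  + (delta R be al * G i ga j k - delta R ga al * G i be k j).

Lemma delta_form_antisym F G : antisymmetric_tensor (delta_form F G).
Proof. by move=> i be ga al j k; rewrite /delta_form; ring. Qed.

(** The part of x + y + z that is a multiple of [delta i j], up to
    antisymmetry.  Each term of z contains both kinds of delta and is counted
    here, so that [correction_p] comes from y alone. *)
Definition correction_q u (be ga al : 'I_p) (k : 'I_q) : R :=
  let N := ((p%:R ^+ 2 - 1) * (q%:R ^+ 2 - 1))^-1 in
  - (q%:R ^+ 2 - 1)^-1 * (q%:R * trace_q u be ga al k + trace_q u ga be al k)
  + delta R be al * (N * ((p%:R * q%:R - 1) * trace_pq u ga k
                          + (q%:R - p%:R) * trace_pq' u ga k))
  - delta R ga al * (N * ((p%:R * q%:R - 1) * trace_pq' u be k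
                          + (q%:R - p%:R) * trace_pq u be k)).

Definition correction_p u (i : 'I_q) (ga : 'I_p) (j k : 'I_q) : R :=
  - (p%:R ^+ 2 - 1)^-1 * (p%:R * trace_p u i ga j k + trace_p u i ga k j).

Lemma a_tildeE u i be ga al j k : a_tilde u i be ga al j k =
  u i be ga al j k + delta_form (correction_q u) (correction_p u) i be ga al j k.
Proof.
rewrite /a_tilde /x_tensor /y_tensor /z_tensor /delta_form
  /correction_q /correction_p /=.
set A := (_^-1); set B := (_^-1); set C := (_^-1); move: A B C => A B C; ring.
Qed.

Lemma a_tilde_antisym u :
  antisymmetric_tensor u -> antisymmetric_tensor (a_tilde u).
Proof.
move=> hu i be ga al j k.
rewrite !a_tildeE [u i be ga al j k]hu.
by rewrite [delta_form _ _ i be ga al j k]delta_form_antisym -opprD.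
Qed.

Lemma trace_q_delta_form F G be ga al k :
  \sum_i delta_form F G i be ga al i k =
  q%:R * F be ga al k - F ga be al k
  + (delta R be al * (\sum_i G i ga i k) - delta R ga al * (\sum_i G i be k i)).
Proof.
rewrite /delta_form big_split /= !sumrB -mulr_suml sum_delta -!mulr_sumr.
by rewrite sum_deltar.
Qed.

Lemma trace_p_delta_form F G i ga j k :
  \sum_al delta_form F G i al ga al j k =
  delta R i j * (\sum_al F al ga al k) - delta R i k * (\sum_al F ga al al j)
  + (p%:R * G i ga j k - G i ga k j).
Proof.
rewrite /delta_form big_split /= !sumrB -mulr_suml sum_delta -!mulr_sumr.
by rewrite sum_deltal.
Qed.

Lemma trace_pqE u ga k : \sum_al trace_q u al ga al k = trace_pq u ga k.
Proof. by rewrite /trace_pq /trace_p exchange_big. Qed.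

(** Antisymmetry exchanges the two lower indices, hence the tilde and the
    sign. *)
Lemma trace_pq'E u ga k : antisymmetric_tensor u ->
  \sum_al trace_q u ga al al k = - trace_pq' u ga k.
Proof.
move=> hu; rewrite /trace_pq' /trace_p /trace_q exchange_big -sumrN.
apply: eq_bigr => l _; rewrite -sumrN; apply: eq_bigr => al _.
exact: hu.
Qed.

Lemma nat_sqr_sub1_neq0 (m : nat) : (2 <= m)%N -> (m%:R ^+ 2 - 1 : R) != 0.
Proof.
move=> hm; have : (2%:R : R) <= m%:R by rewrite ler_nat.
by move=> h; apply/eqP => e; move: h e; set t := m%:R => h e; nra.
Qed.

(** After the traces of the corrections are expressed by those of u, each
    condition is an identity of rational functions in p and q, in which the
    single traces cancel between u and one of x, y, and the double traces
    between the other one and z. *)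
Lemma a_tilde_trace_free u : (2 <= p)%N -> (2 <= q)%N ->
  antisymmetric_tensor u -> trace_free (a_tilde u).
Proof.
move=> hp hq hu.
have p0 := nat_sqr_sub1_neq0 hp; have q0 := nat_sqr_sub1_neq0 hq.
split=> [be ga al k|i ga j k];
  under eq_bigr do rewrite a_tildeE; rewrite big_split /=.
  rewrite trace_q_delta_form.
  have -> : \sum_i correction_p u i ga i k =
    - (p%:R ^+ 2 - 1)^-1 * (p%:R * trace_pq u ga k + trace_pq' u ga k).
    by rewrite /correction_p -mulr_sumr big_split /= -mulr_sumr.
  have -> : \sum_i correction_p u i be k i =
    - (p%:R ^+ 2 - 1)^-1 * (p%:R * trace_pq' u be k + trace_pq u be k).
    by rewrite /correction_p -mulr_sumr big_split /= -mulr_sumr.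
  rewrite -[\sum_i u _ _ _ _ _ _]/(trace_q u be ga al k) /correction_q /=.
  by field; rewrite p0 q0.
rewrite trace_p_delta_form -[\sum_i u _ _ _ _ _ _]/(trace_p u i ga j k).
have E1 (r : R) : \sum_(al < p) delta R al al * r = p%:R * r.
  by rewrite -mulr_suml sum_delta.
rewrite /correction_q !sumrB !big_split /= -!mulr_sumr !big_split /=.
rewrite -!mulr_sumr !trace_pqE !(trace_pq'E _ _ hu) !E1 !sum_deltal.
rewrite /correction_p.
by field; rewrite p0 q0.
Qed.

(** A trace-free tensor C is orthogonal to every delta form: the sum of
    C * delta i j * F collapses to the sum of F times a trace of C.  When C is
    itself a delta form, the sum of the squares of its components is zero. *)
Lemma trace_free_delta_form_eq0 F G : trace_free (delta_form F G) ->
  forall i be ga al j k, delta_form F G i be ga al j k = 0.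
Proof.
set C := delta_form F G => -[tq tp].
have aC : antisymmetric_tensor C by exact: delta_form_antisym.
have tq' be ga al j : \sum_i C i be ga al j i = 0.
  by under eq_bigr do rewrite aC; rewrite sumrN tq oppr0.
have tp' i be j k : \sum_al C i be al al j k = 0.
  by under eq_bigr do rewrite aC; rewrite sumrN tp oppr0.
have Z : \sum_be \sum_ga \sum_al \sum_i \sum_j \sum_k C i be ga al j k ^+ 2 = 0.
  have -> : \sum_be \sum_ga \sum_al \sum_i \sum_j \sum_k C i be ga al j k ^+ 2 =
    \sum_be \sum_ga \sum_al \sum_i \sum_j \sum_k
      (delta R i j * (C i be ga al j k * F be ga al k)
       - delta R i k * (C i be ga al j k * F ga be al j))
    + \sum_be \sum_ga \sum_al \sum_i \sum_j \sum_k
      (delta R be al * (C i be ga al j k * G i ga j k)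
       - delta R ga al * (C i be ga al j k * G i be k j)).
    do 6![rewrite -big_split /=; apply: eq_bigr => ? _].
    by rewrite expr2 {2}/C /delta_form; ring.
  have Zq be ga al : \sum_i \sum_j \sum_k
      (delta R i j * (C i be ga al j k * F be ga al k)
       - delta R i k * (C i be ga al j k * F ga be al j)) = 0.
    under eq_bigr do under eq_bigr do rewrite sumrB -mulr_sumr sum_deltal.
    under eq_bigr do rewrite sumrB sum_deltal.
    rewrite sumrB exchange_big big1 => [|k _]; last by rewrite -mulr_suml tq mul0r.
    by rewrite exchange_big big1 ?subrr // => j _; rewrite -mulr_suml tq' mul0r.
  have Zp i j k : \sum_be \sum_ga \sum_al
      (delta R be al * (C i be ga al j k * G i ga j k)
       - delta R ga al * (C i be ga al j k * G i be k j)) = 0.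
    under eq_bigr do under eq_bigr do rewrite sumrB !sum_deltal.
    rewrite (eq_bigr _ (fun _ _ => sumrB _ _ _ _)) sumrB exchange_big.
    rewrite big1 => [|ga _]; last by rewrite -mulr_suml tp mul0r.
    by rewrite big1 ?subrr // => be _; rewrite -mulr_suml tp' mul0r.
  rewrite [X in X + _]big1 ?add0r; last first.
    by move=> be _; rewrite big1 // => ga _; rewrite big1.
  by rewrite exchange_big33 big1 // => i _; rewrite big1 // => j _; rewrite big1.
move=> i be ga al j k; apply/eqP; rewrite -sqrf_eq0; apply/eqP.
move/psum_eq0/(_ be)/psum_eq0/(_ ga)/psum_eq0/(_ al)/psum_eq0/(_ i)
  /psum_eq0/(_ j)/psum_eq0/(_ k): Z.
by apply=> *; do ?[apply: sumr_ge0 => * ]; exact: sqr_ge0.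
Qed.
End TraceDecomposition.

(** * Absorption of delta forms into the fiber forms *)

Section StructureValue.
Variables (R : realType) (p q : nat).

(** Value on two vectors of the 2-form u omega ^ omega; [W] and [W'] hold the
    values of the coframe on the first and on the second vector. *)
Definition torsion_value (u : tensor R p q) (W W' : 'I_p -> 'I_q -> R) al i : R :=
  \sum_be \sum_ga \sum_j \sum_k
    u i be ga al j k * (W be j * W' ga k - W' be j * W ga k).

(** Value on two vectors of the right-hand side of the structure equation, as a
    function of the values of the 1-forms: unprimed on the first vector, primed
    on the second. *)
Definition structure_value (u : tensor R p q)
    (th th' : 'I_p -> 'I_p -> R) (ph ph' : 'I_q -> 'I_q -> R) (om om' : R)
    (W W' : 'I_p -> 'I_q -> R) (al : 'I_p) (i : 'I_q) : R :=
  \sum_be (th al be * W' be i - th' al be * W be i)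
  + \sum_j (W al j * ph' j i - W' al j * ph j i)
  + (om * W' al i - om' * W al i)
  + torsion_value u W W' al i.

Lemma exchange_pairs (f : 'I_p -> 'I_p -> 'I_q -> 'I_q -> R) :
  \sum_be \sum_ga \sum_j \sum_k f be ga j k =
  \sum_be \sum_ga \sum_j \sum_k f ga be k j.
Proof.
rewrite exchange_big; apply: eq_bigr => be _; apply: eq_bigr => ga _.
exact: exchange_big.
Qed.

(** A delta is contracted with one of the two coframe factors, so the 2-form
    is a coframe element wedge a combination of the coframe.  The factor 2
    accounts for the two antisymmetric halves of the delta form. *)
Lemma torsion_value_delta_form F G (W W' : 'I_p -> 'I_q -> R) al i :
  torsion_value (delta_form F G) W W' al i =
  2 * (\sum_be (W be i * (\sum_ga \sum_k F be ga al k * W' ga k)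
                - W' be i * (\sum_ga \sum_k F be ga al k * W ga k))
       + \sum_j (W al j * (\sum_ga \sum_k G i ga j k * W' ga k)
                - W' al j * (\sum_ga \sum_k G i ga j k * W ga k))).
Proof.
pose E be ga j k : R := (delta R i j * F be ga al k + delta R be al * G i ga j k)
  * (W be j * W' ga k - W' be j * W ga k).
have -> : torsion_value (delta_form F G) W W' al i =
    \sum_be \sum_ga \sum_j \sum_k (E be ga j k + E ga be k j).
  do 4![apply: eq_bigr => ? _]; rewrite /E /delta_form; ring.
have -> : \sum_be \sum_ga \sum_j \sum_k (E be ga j k + E ga be k j) =
    2 * \sum_be \sum_ga \sum_j \sum_k E be ga j k.
  have E1 := exchange_pairs E.
  rewrite mulr2n mulrDl mul1r {2}E1.
  by do 4![rewrite -big_split /=; apply: eq_bigr => ? _].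
congr (_ * _).
have -> : \sum_be \sum_ga \sum_j \sum_k E be ga j k =
    \sum_be \sum_ga \sum_j delta R i j *
       (\sum_k F be ga al k * (W be j * W' ga k - W' be j * W ga k))
    + \sum_be delta R be al * (\sum_ga \sum_j
       \sum_k G i ga j k * (W be j * W' ga k - W' be j * W ga k)).
  rewrite -big_split; apply: eq_bigr => be _; rewrite /= mulr_sumr.
  rewrite -big_split; apply: eq_bigr => ga _; rewrite /= mulr_sumr.
  rewrite -big_split; apply: eq_bigr => j _; rewrite /= !mulr_sumr.
  by rewrite -big_split; apply: eq_bigr => k _; rewrite /= /E; ring.
congr (_ + _).
  apply: eq_bigr => be _; rewrite !mulr_sumr -sumrB; apply: eq_bigr => ga _.
  rewrite sum_deltal !mulr_sumr -sumrB; apply: eq_bigr => k _; ring.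
rewrite sum_deltar exchange_big; apply: eq_bigr => j _.
rewrite !mulr_sumr -sumrB; apply: eq_bigr => ga _.
by rewrite !mulr_sumr -sumrB; apply: eq_bigr => k _; ring.
Qed.

End StructureValue.

Section Absorption.
Variables (R : realType) (p q : nat) (M : topologicalType).
Variable S : smooth_manifold R (p * q) M.
Notation field := (M -> components S).

Lemma structure_rhs_entry c x (w : 'I_p -> 'I_q -> field) th ph (om : field)
    (u : tensor R p q) al i (a b : 'I_(p * q)) :
  (\sum_(be < p) wedge c (th al be) (w be i) x
   + \sum_(j < q) wedge c (w al j) (ph j i) x
   + wedge c om (w al i) x
   + \sum_(be < p) \sum_(ga < p) \sum_(j < q) \sum_(k < q)
       u i be ga al j k *: wedge c (w be j) (w ga k) x) a b =
  structure_value u (fun al be => th al be x c 0 a) (fun al be => th al be x c 0 b)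
    (fun j i => ph j i x c 0 a) (fun j i => ph j i x c 0 b)
    (om x c 0 a) (om x c 0 b)
    (fun al i => w al i x c 0 a) (fun al i => w al i x c 0 b) al i.
Proof.
rewrite 3![in LHS]mxE /structure_value; congr (_ + _ + _ + _).
- by rewrite summxE; apply: eq_bigr => be _; rewrite mxE; ring.
- by rewrite summxE; apply: eq_bigr => j _; rewrite mxE; ring.
- by rewrite mxE; ring.
rewrite summxE; apply: eq_bigr => be _; rewrite summxE; apply: eq_bigr => ga _.
rewrite summxE; apply: eq_bigr => j _; rewrite summxE; apply: eq_bigr => k _.
by rewrite !mxE; ring.
Qed.

Lemma structure_equation_entry (U : set M) (w : 'I_p -> 'I_q -> field) th ph om u
    (c : chart S) x al i a b :
  second_order_frame U w th ph om u -> U x -> dom c x ->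
  ext_d c (w al i) x a b =
  structure_value (u x)
    (fun al be => th al be x c 0 a) (fun al be => th al be x c 0 b)
    (fun j i => ph j i x c 0 a) (fun j i => ph j i x c 0 b)
    (om x c 0 a) (om x c 0 b)
    (fun al i => w al i x c 0 a) (fun al i => w al i x c 0 b) al i.
Proof. by move=> h Ux cx; rewrite (sof_structure h Ux cx) structure_rhs_entry. Qed.

(** With Psi = F omega and Gamma = G omega, the 2-form of the delta form is
    - 2 Psi ^ omega + 2 omega ^ Gamma.  Adding it to the torsion is compensated
    by adding 2 Psi to th and - 2 Gamma to ph.  To keep th and ph trace-free,
    the scalar parts of Psi and Gamma are put into om instead. *)
Lemma absorb_delta_form (U : set M) (w : 'I_p -> 'I_q -> field) th ph om u F G :
  open U -> (0 < p)%N -> (0 < q)%N -> (forall al i, one_form U (w al i)) ->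
  (forall be ga al k, smooth_fun S U (fun x => F x be ga al k)) ->
  (forall i ga j k, smooth_fun S U (fun x => G x i ga j k)) ->
  second_order_frame U w th ph om u ->
  exists th' ph' om', second_order_frame U w th' ph' om'
    (fun x i be ga al j k => u x i be ga al j k + delta_form (F x) (G x) i be ga al j k).
Proof.
move=> oU p0 q0 hw hF hG hu.
have pN0 : (p%:R : R) != 0 by rewrite pnatr_eq0 -lt0n.
have qN0 : (q%:R : R) != 0 by rewrite pnatr_eq0 -lt0n.
pose Psi al be : field := fun x c => \sum_ga \sum_k F x be ga al k *: w ga k x c.
pose Gam j i : field := fun x c => \sum_ga \sum_k G x i ga j k *: w ga k x c.
pose tPsi : field := fun x c => \sum_al Psi al al x c.
pose tGam : field := fun x c => \sum_j Gam j j x c.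
have sPsi al be : one_form U (Psi al be).
  by apply: one_form_sum => // ga; apply: one_form_sum => // k; exact: one_formZ.
have sGam j i : one_form U (Gam j i).
  by apply: one_form_sum => // ga; apply: one_form_sum => // k; exact: one_formZ.
have stPsi : one_form U tPsi by apply: one_form_sum.
have stGam : one_form U tGam by apply: one_form_sum.
have Zc r v : one_form (S := S) U v -> one_form U (fun x c => r *: v x c).
  by move=> hv; apply: one_formZ => //; exact: smooth_fun_cst.
pose th' al be : field := fun x c =>
  th al be x c + 2 *: Psi al be x c + (- (2 / p%:R) * delta R al be) *: tPsi x c.
pose ph' j i : field := fun x c =>
  ph j i x c + (- 2) *: Gam j i x c + (2 / q%:R * delta R j i) *: tGam x c.
pose om' : field := fun x c =>
  om x c + (2 / p%:R) *: tPsi x c + (2 / q%:R) *: tGam x c.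
exists th', ph', om'; split.
- move=> al be; apply: one_formD => //; last exact: Zc.
  by apply: one_formD => //; [exact: (sof_one_form_th hu)|exact: Zc].
- move=> j i; apply: one_formD => //; last exact: Zc.
  by apply: one_formD => //; [exact: (sof_one_form_ph hu)|exact: Zc].
- apply: one_formD => //; last exact: Zc.
  by apply: one_formD => //; [exact: (sof_one_form_om hu)|exact: Zc].
- move=> x Ux c; rewrite !big_split /= (sof_trace_th hu Ux) add0r -scaler_sumr.
  rewrite -scaler_suml -mulr_sumr sum_delta mulNr divfK //.
  by rewrite scaleNr subrr.
- move=> x Ux c; rewrite !big_split /= (sof_trace_ph hu Ux) add0r -scaler_sumr.
  by rewrite -scaler_suml -mulr_sumr sum_delta divfK // scaleNr addNr.
- move=> i be ga al j k; apply: smooth_funD => //; first exact: (sof_smooth hu).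
  have cF r f : smooth_fun S U f -> smooth_fun S U (fun x => r * f x).
    by move=> hf; apply: smooth_funM => //; exact: smooth_fun_cst.
  by apply: smooth_funD => //; apply: smooth_funB => //; exact: cF.
- move=> x Ux i be ga al j k; rewrite [u _ _ _ _ _ _ _](sof_antisymmetric hu Ux).
  by rewrite [delta_form _ _ i be ga al j k]delta_form_antisym -opprD.
move=> x c Ux cx al i; apply/matrixP => a b.
apply: etrans _ (esym (structure_rhs_entry c x w th' ph' om'
  (fun i be ga al j k =>
     u x i be ga al j k + delta_form (F x) (G x) i be ga al j k) al i a b)).
rewrite (structure_equation_entry al i a b hu Ux cx).
rewrite /structure_value.
set W := fun al i => w al i x c 0 a; set W' := fun al i => w al i x c 0 b.
have PsiE al' be d : Psi al' be x c 0 d = \sum_ga \sum_k F x be ga al' k * w ga k x c 0 d.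
  rewrite summxE; apply: eq_bigr => ga _; rewrite summxE; apply: eq_bigr => k _.
  by rewrite mxE.
have GamE j i' d : Gam j i' x c 0 d = \sum_ga \sum_k G x i' ga j k * w ga k x c 0 d.
  rewrite summxE; apply: eq_bigr => ga _; rewrite summxE; apply: eq_bigr => k _.
  by rewrite mxE.
have -> : torsion_value
    (fun i be ga al j k => u x i be ga al j k + delta_form (F x) (G x) i be ga al j k)
    W W' al i = torsion_value (u x) W W' al i
    + torsion_value (delta_form (F x) (G x)) W W' al i.
  rewrite /torsion_value; do 4![rewrite -big_split /=; apply: eq_bigr => ? _].
  by rewrite mulrDl.
rewrite torsion_value_delta_form.
under [X in 2 * (X + _)]eq_bigr do rewrite -!PsiE.
under [X in 2 * (_ + X)]eq_bigr do rewrite -!GamE.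
have linE (r s : R) (y z t : 'rV[R]_(p * q)) d :
    (y + r *: z + s *: t) 0 d = y 0 d + r * z 0 d + s * t 0 d by rewrite !mxE.
have thE al' be d : th' al' be x c 0 d = th al' be x c 0 d + 2 * Psi al' be x c 0 d
    - (2 / p%:R) * delta R al' be * tPsi x c 0 d.
  by rewrite /th' linE !mulNr.
have phE j i' d : ph' j i' x c 0 d = ph j i' x c 0 d - 2 * Gam j i' x c 0 d
    + (2 / q%:R) * delta R j i' * tGam x c 0 d.
  by rewrite /ph' linE mulNr.
have omE d : om' x c 0 d = om x c 0 d + 2 / p%:R * tPsi x c 0 d
   + 2 / q%:R * tGam x c 0 d by rewrite /om' linE.
have -> : \sum_be (th' al be x c 0 a * W' be i - th' al be x c 0 b * W be i) =
    \sum_be (th al be x c 0 a * W' be i - th al be x c 0 b * W be i)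
    - 2 * \sum_be (W be i * Psi al be x c 0 b - W' be i * Psi al be x c 0 a)
    - 2 / p%:R * (tPsi x c 0 a * W' al i - tPsi x c 0 b * W al i).
  have -> : tPsi x c 0 a * W' al i - tPsi x c 0 b * W al i = 
    \sum_be delta R al be * (tPsi x c 0 a * W' be i - tPsi x c 0 b * W be i).
    by rewrite sum_deltal.
  rewrite !mulr_sumr -!sumrB; apply: eq_bigr => be _; rewrite !thE; ring.
have -> : \sum_j (W al j * ph' j i x c 0 b - W' al j * ph' j i x c 0 a) =
    \sum_j (W al j * ph j i x c 0 b - W' al j * ph j i x c 0 a)
    - 2 * \sum_j (W al j * Gam j i x c 0 b - W' al j * Gam j i x c 0 a)
    + 2 / q%:R * (W al i * tGam x c 0 b - W' al i * tGam x c 0 a).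
  have -> : W al i * tGam x c 0 b - W' al i * tGam x c 0 a =
    \sum_j delta R j i * (W al j * tGam x c 0 b - W' al j * tGam x c 0 a).
    by rewrite sum_deltar.
  rewrite !mulr_sumr -sumrB -big_split; apply: eq_bigr => j _; rewrite /= !phE; ring.
rewrite !omE /W /W' /=; ring.
Qed.

Lemma normalized_second_order_frame (U : set M) (w : 'I_p -> 'I_q -> field)
    th ph om u :
  open U -> (2 <= p)%N -> (2 <= q)%N -> (forall al i, one_form U (w al i)) ->
  second_order_frame U w th ph om u ->
  torsion_tensor U w (fun x => a_tilde (u x)).
Proof.
move=> oU hp hq hw hu.
have C r : smooth_fun S U (fun=> r) by exact: smooth_fun_cst.
have su := sof_smooth hu.
have sq be ga al k : smooth_fun S U (fun x => trace_q (u x) be ga al k).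
  by apply: smooth_fun_sum.
have sp i ga j k : smooth_fun S U (fun x => trace_p (u x) i ga j k).
  by apply: smooth_fun_sum.
have sT ga k : smooth_fun S U (fun x => trace_pq (u x) ga k).
  by apply: smooth_fun_sum.
have sT' ga k : smooth_fun S U (fun x => trace_pq' (u x) ga k).
  by apply: smooth_fun_sum.
have cM r f : smooth_fun S U f -> smooth_fun S U (fun x => r * f x).
  by move=> sf; apply: smooth_funM.
have sF be ga al k : smooth_fun S U (fun x => correction_q (u x) be ga al k).
  rewrite /correction_q /=; apply: smooth_funB => //.
    apply: smooth_funD => //.
      by apply: (cM _ _); apply: smooth_funD => //; exact: (cM _ _).
    by do 2!apply: (cM _ _); apply: smooth_funD => //; exact: (cM _ _).
  by do 2!apply: (cM _ _); apply: smooth_funD => //; exact: (cM _ _).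
have sG i ga j k : smooth_fun S U (fun x => correction_p (u x) i ga j k).
  by apply: (cM _ _); apply: smooth_funD => //; exact: (cM _ _).
have [th' [ph' [om' h]]] := absorb_delta_form oU (ltnW hp) (ltnW hq) hw sF sG hu.
exists th', ph', om'; split; last first.
  by move=> x Ux; apply: a_tilde_trace_free => //; exact: (sof_antisymmetric hu).
have -> : (fun x => a_tilde (u x)) = fun x i be ga al j k =>
    u x i be ga al j k
    + delta_form (correction_q (u x)) (correction_p (u x)) i be ga al j k.
  apply/funext => x; do 6![apply/funext => ?]; exact: a_tildeE.
exact: h.
Qed.

End Absorption.

(** * Trace-free tensors under a change of frame *)

Section TwistedTraces.
Variables (R : realType) (p q : nat).

Lemma sum_mulmx1 m (A B : 'M[R]_m) a (f : 'I_m -> R) : A *m B = 1%:M ->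
  \sum_b A a b * (\sum_c B b c * f c) = f a.
Proof.
move=> AB; under eq_bigr do rewrite mulr_sumr; rewrite exchange_big /=.
rewrite -[RHS]sum_deltal; apply: eq_bigr => c _.
under eq_bigr do rewrite mulrA; rewrite -mulr_suml; congr (_ * _).
by move/matrixP: AB => /(_ a c); rewrite !mxE => ->.
Qed.

(** A twisted trace, taken in the indices i and l, commutes with linear
    operations on the other indices. *)
Lemma double_sum_push (I J K : finType) (A : J -> I -> R) (B : K -> R)
    (X : I -> J -> K -> R) :
  (forall b, \sum_i \sum_l A l i * X i l b = 0) ->
  \sum_i \sum_l A l i * (\sum_b B b * X i l b) = 0.
Proof.
move=> h; transitivity (\sum_b B b * \sum_i \sum_l A l i * X i l b); last first.
  by rewrite big1 // => b _; rewrite h mulr0.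
under [RHS]eq_bigr do rewrite mulr_sumr; rewrite [RHS]exchange_big.
apply: eq_bigr => i _; under [RHS]eq_bigr do rewrite mulr_sumr.
rewrite [RHS]exchange_big; apply: eq_bigr => l _.
by rewrite mulr_sumr; apply: eq_bigr => b _; ring.
Qed.

Lemma trace_conj m (A B : 'M[R]_m) (X : 'I_m -> 'I_m -> R) : A *m B = 1%:M ->
  \sum_i \sum_l A l i * (\sum_j B i j * X l j) = \sum_l X l l.
Proof.
move=> AB; rewrite exchange_big; apply: eq_bigr => l _.
exact: (sum_mulmx1 l (X l) AB).
Qed.

(** The hypothesis says that the defect of the transformation law is a delta
    form twisted by P and Q.  Applying P^-1 and Q^-1 to the free indices
    untwists it; the resulting delta form is a difference of v' and of a
    transform of v, both trace-free, so it vanishes. *)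
Lemma tensor_lawP (P : 'M[R]_p) (Q : 'M[R]_q) (v v' : tensor R p q) F G :
  P \in unitmx -> Q \in unitmx -> trace_free v -> trace_free v' ->
  (forall l be ga de j k,
    \sum_al \sum_i P de al * Q i l * v' i be ga al j k
    - \sum_be' \sum_ga' \sum_j' \sum_k'
        P be' be * Q j j' * (P ga' ga * Q k k') * v l be' ga' de j' k' =
    Q j l * F be ga de k - Q k l * F ga be de j
    + (P de be * G l ga j k - P de ga * G l be k j)) ->
  tensor_law P Q v v'.
Proof.
move=> uP uQ [vq vp] [vq' vp'] H.
pose rhs l be ga de j k := \sum_be' \sum_ga' \sum_j' \sum_k'
        P be' be * Q j j' * (P ga' ga * Q k k') * v l be' ga' de j' k'.
pose T l be ga de j k :=
  \sum_al \sum_i P de al * Q i l * v' i be ga al j k - rhs l be ga de j k.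
set Pi := invmx P; set Qi := invmx Q.
have PPi : P *m Pi = 1%:M by rewrite mulmxV.
have PiP : Pi *m P = 1%:M by rewrite mulVmx.
have QQi : Q *m Qi = 1%:M by rewrite mulmxV.
have QiQ : Qi *m Q = 1%:M by rewrite mulVmx.
(* The summation order decides which index can be traced first: j' in [rhs_q]
   and be' in [rhs_p]. *)
have rhs_q l be ga de j k : rhs l be ga de j k =
  \sum_be' P be' be * (\sum_ga' P ga' ga * (\sum_k' Q k k' * (\sum_j' Q j j' *
     v l be' ga' de j' k'))).
  apply: eq_bigr => be' _; rewrite mulr_sumr; apply: eq_bigr => ga' _.
  rewrite exchange_big 2!mulr_sumr; apply: eq_bigr => k' _.
  by rewrite /= 3!mulr_sumr; apply: eq_bigr => j' _; ring.
have rhs_p l be ga de j k : rhs l be ga de j k =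
  \sum_ga' P ga' ga * (\sum_k' Q k k' * (\sum_j' Q j j' *
     (\sum_be' P be' be * v l be' ga' de j' k'))).
  rewrite /rhs exchange_big; apply: eq_bigr => ga' _.
  rewrite exchange_big mulr_sumr.
  under eq_bigr do rewrite exchange_big; rewrite exchange_big.
  apply: eq_bigr => k' _; rewrite 2!mulr_sumr; apply: eq_bigr => j' _.
  by rewrite /= 3!mulr_sumr; apply: eq_bigr => be' _; ring.
pose F1 be ga al k := \sum_de Pi al de * F be ga de k.
pose G1 i ga j k := \sum_l Qi l i * G l ga j k.
have TE l be ga de j k : T l be ga de j k =
    Q j l * F be ga de k - Q k l * F ga be de j
    + (P de be * G l ga j k - P de ga * G l be k j) by exact: H.
have inv1 m (A B : 'M[R]_m) a b : A *m B = 1%:M ->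
    \sum_c B c b * A a c = delta R b a.
  move/matrixP => /(_ a b); rewrite !mxE deltaC /delta => <-.
  by apply: eq_bigr => c _; rewrite mulrC.
have CE i be ga al j k :
    \sum_de Pi al de * (\sum_l Qi l i * T l be ga de j k) =
    delta_form F1 G1 i be ga al j k.
  have inner de : \sum_l Qi l i * T l be ga de j k =
     delta R i j * F be ga de k - delta R i k * F ga be de j
     + (P de be * G1 i ga j k - P de ga * G1 i be k j).
    transitivity (\sum_l (Qi l i * Q j l * F be ga de k - Qi l i * Q k l * F ga be de j
        + (P de be * (Qi l i * G l ga j k) - P de ga * (Qi l i * G l be k j)))).
      by apply: eq_bigr => l _; rewrite TE; ring.
    by rewrite big_split /= !sumrB -!mulr_suml -!mulr_sumr !(inv1 _ _ _ _ _ QQi).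
  transitivity (\sum_de
      (delta R i j * (Pi al de * F be ga de k) - delta R i k * (Pi al de * F ga be de j)
       + (P de be * Pi al de * G1 i ga j k - P de ga * Pi al de * G1 i be k j))).
    by apply: eq_bigr => de _; rewrite inner; ring.
  by rewrite big_split /= !sumrB -!mulr_suml -!mulr_sumr !(inv1 _ _ _ _ _ PiP).
have CE' i be ga al j k : delta_form F1 G1 i be ga al j k = v' i be ga al j k -
    \sum_de Pi al de * (\sum_l Qi l i * rhs l be ga de j k).
  rewrite -CE; apply/eqP; rewrite -subr_eq opprK -big_split /=; apply/eqP.
  rewrite -[RHS](sum_mulmx1 al (v' i be ga ^~ j ^~ k) PiP).
  apply: eq_bigr => de _; rewrite -mulrDr -big_split /=; congr (_ * _).
  transitivity (\sum_l Qi l i * (\sum_i' Q i' l * \sum_al' P de al' * v' i' be ga al' j k)).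
    apply: eq_bigr => l _; rewrite -mulrDr /T subrK exchange_big; congr (_ * _).
    by apply: eq_bigr => i' _; rewrite mulr_sumr; apply: eq_bigr => al' _; ring.
  have QQt : Qi^T *m Q^T = 1%:M by rewrite -trmx_mul QQi trmx1.
  rewrite -[RHS](sum_mulmx1 i (fun i' => \sum_al' P de al' * v' i' be ga al' j k) QQt).
  by apply: eq_bigr => l _; rewrite mxE; congr (_ * _);
    apply: eq_bigr => i' _; rewrite mxE.
have C0 : forall i be ga al j k, delta_form F1 G1 i be ga al j k = 0.
  apply: trace_free_delta_form_eq0; split=> [be ga al k|i ga j k].
    under eq_bigr do rewrite CE'.
    rewrite sumrB vq' sub0r exchange_big big1 ?oppr0 // => de _.
    rewrite -mulr_sumr; under eq_bigr do under eq_bigr do rewrite rhs_q.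
    rewrite (_ : \sum_i _ = 0) ?mulr0 //.
    do 3![apply: double_sum_push => ?].
    by rewrite (trace_conj (fun l j' => v l _ _ de j' _) QiQ) vq.
  under eq_bigr do rewrite CE'.
  rewrite sumrB vp' sub0r.
  rewrite (_ : \sum_al _ = 0) ?oppr0 //.
  apply: (double_sum_push (A := fun de al => Pi al de)) => l.
  under eq_bigr do under eq_bigr do rewrite rhs_p.
  apply: (double_sum_push (A := fun de al => Pi al de)) => ga'.
  apply: (double_sum_push (A := fun de al => Pi al de)) => k'.
  apply: (double_sum_push (A := fun de al => Pi al de)) => j'.
  have PPt : Pi^T *m P^T = 1%:M by rewrite -trmx_mul PPi trmx1.
  rewrite -[RHS](vp l ga' j' k').
  rewrite -(trace_conj (fun de be' => v l be' ga' de j' k') PPt).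
  apply: eq_bigr => al _; apply: eq_bigr => de _; rewrite mxE; congr (_ * _).
  by apply: eq_bigr => be' _; rewrite mxE.
have T0 l be ga de j k : T l be ga de j k = 0.
  have QQt : Q^T *m Qi^T = 1%:M by rewrite -trmx_mul QiQ trmx1.
  rewrite -(sum_mulmx1 de (fun de' => T l be ga de' j k) PPi) big1 // => al _.
  rewrite (_ : \sum_de' _ = 0) ?mulr0 //.
  under eq_bigr do rewrite -(sum_mulmx1 l (fun l' => T l' be ga _ j k) QQt).
  under eq_bigr do rewrite mulr_sumr; rewrite exchange_big big1 // => i _.
  transitivity (Q^T l i * delta_form F1 G1 i be ga al j k); last by rewrite C0 mulr0.
  rewrite -CE mulr_sumr; apply: eq_bigr => de' _; rewrite mulrCA; congr (_ * (_ * _)).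
  by apply: eq_bigr => l' _; rewrite mxE.
by move=> l be ga de j k; apply/eqP; rewrite -subr_eq0; apply/eqP; exact: T0.
Qed.

End TwistedTraces.

(** * Comparison of two structure equations *)

Section StructureComparison.
Variables (R : realType) (p q : nat).

Lemma torsion_valueE (u : tensor R p q) (W W' : 'I_p -> 'I_q -> R) al i :
  antisymmetric_tensor u -> torsion_value u W W' al i =
  2 * \sum_be \sum_ga \sum_j \sum_k u i be ga al j k * (W be j * W' ga k).
Proof.
move=> hu; rewrite mulr2n mulrDl mul1r.
have E := exchange_pairs (fun be ga j k => u i be ga al j k * (W be j * W' ga k)).
rewrite {2}E; do 4![rewrite -big_split /=; apply: eq_bigr => ? _].
by rewrite [X in _ + X * _]hu; ring.
Qed.

Lemma sum2_delta (f : 'I_p -> 'I_q -> R) be j :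
  \sum_al \sum_i f al i * (delta R al be * delta R i j) = f be j.
Proof.
transitivity (\sum_al delta R al be * \sum_i delta R i j * f al i).
  by apply: eq_bigr => al _; rewrite mulr_sumr; apply: eq_bigr => i _; ring.
by rewrite !sum_deltar.
Qed.

(** The structure equation evaluated on the vectors e_j^be and e_k^ga of the
    frame dual to the coframe. *)
Lemma structure_value_delta (u : tensor R p q) th th' ph ph' om om' be ga j k al i :
  antisymmetric_tensor u ->
  structure_value u th th' ph ph' om om'
    (fun al i => delta R al be * delta R i j)
    (fun al i => delta R al ga * delta R i k) al i =
  delta R i k * th al ga - delta R i j * th' al be
  + (delta R al be * ph' j i - delta R al ga * ph k i)
  + (om * (delta R al ga * delta R i k) - om' * (delta R al be * delta R i j))
  + 2 * u i be ga al j k.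
Proof.
move=> hu; rewrite /structure_value torsion_valueE //; congr (_ + _ + _ + 2 * _).
- rewrite sumrB -(sum_deltar ga (th al)) -(sum_deltar be (th' al)) !mulr_sumr.
  by rewrite -!sumrB; apply: eq_bigr => b _; ring.
- rewrite sumrB -(sum_deltar j (ph' ^~ i)) -(sum_deltar k (ph ^~ i)) !mulr_sumr.
  by rewrite -!sumrB; apply: eq_bigr => b _; ring.
rewrite -[RHS](sum2_delta (fun b j' => u i b ga al j' k)).
apply: eq_bigr => b _; rewrite exchange_big; apply: eq_bigr => j' _.
rewrite -(sum2_delta (fun g k' => u i b g al j' k') ga k) mulr_suml.
apply: eq_bigr => g _; rewrite mulr_suml; apply: eq_bigr => k' _; ring.
Qed.

(** Half of the 1-form P th' + om' P - th P - om P + dP, which measures how far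
    the forms th and om are from being related by P; [fiber_p] plays the same
    role for ph and Q.  Each of the arguments is the value of a form on one
    vector. *)
Definition fiber_q (P : 'M[R]_p) (th th' : 'I_p -> 'I_p -> R) (om om' : R)
    (dP : 'I_p -> 'I_p -> R) de be :=
  2^-1 * (\sum_al P de al * th' al be + om' * P de be
          - \sum_b th de b * P b be - om * P de be + dP de be).

Definition fiber_p (Q : 'M[R]_q) (ph ph' : 'I_q -> 'I_q -> R)
    (dQ : 'I_q -> 'I_q -> R) j l :=
  2^-1 * (\sum_i Q j i * ph i l - \sum_i Q i l * ph' j i + dQ j l).

(** The hypothesis is the derivative of w = P Q w' evaluated on e'_j^be and
    e'_k^ga, with d w and d w' replaced by their structure equations.  Index 1
    or 2 tells on which of the two vectors a form is evaluated. *)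
Lemma structure_comparison (P : 'M[R]_p) (Q : 'M[R]_q) (u u' : tensor R p q)
   t1 t2 f1 f2 o1 o2 t1' t2' f1' f2' o1' o2' dP1 dP2 dQ1 dQ2 be ga j k de l :
  antisymmetric_tensor u -> antisymmetric_tensor u' ->
  structure_value u t1 t2 f1 f2 o1 o2
    (fun b i => P b be * Q j i) (fun b i => P b ga * Q k i) de l =
  \sum_al \sum_i (
    ((dP1 de al * Q i l + P de al * dQ1 i l) * (delta R al ga * delta R i k)
     - (dP2 de al * Q i l + P de al * dQ2 i l) * (delta R al be * delta R i j))
    + P de al * Q i l *
       structure_value u' t1' t2' f1' f2' o1' o2'
         (fun al i => delta R al be * delta R i j)
         (fun al i => delta R al ga * delta R i k) al i) ->
  \sum_al \sum_i P de al * Q i l * u' i be ga al j k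
    - \sum_be' \sum_ga' \sum_j' \sum_k'
        P be' be * Q j j' * (P ga' ga * Q k k') * u l be' ga' de j' k' =
  Q j l * fiber_q P t2 t2' o2 o2' dP2 de be - Q k l * fiber_q P t1 t1' o1 o1' dP1 de ga
  + (P de be * fiber_p Q f2 f2' dQ2 j l - P de ga * fiber_p Q f1 f1' dQ1 k l).
Proof.
move=> hu hu' H.
have E1 : structure_value u t1 t2 f1 f2 o1 o2
    (fun b i => P b be * Q j i) (fun b i => P b ga * Q k i) de l =
  Q k l * (\sum_b t1 de b * P b ga) - Q j l * (\sum_b t2 de b * P b be)
  + (P de be * (\sum_i Q j i * f2 i l) - P de ga * (\sum_i Q k i * f1 i l))
  + (o1 * (P de ga * Q k l) - o2 * (P de be * Q j l))
  + 2 * \sum_be' \sum_ga' \sum_j' \sum_k'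
      P be' be * Q j j' * (P ga' ga * Q k k') * u l be' ga' de j' k'.
  rewrite /structure_value torsion_valueE //; congr (_ + _ + _ + 2 * _).
  - by rewrite !mulr_sumr -sumrB; apply: eq_bigr => b _; ring.
  - by rewrite !mulr_sumr -sumrB; apply: eq_bigr => b _; ring.
  by do 4![apply: eq_bigr => ? _]; ring.
rewrite {}E1 in H.
set L := \sum_al \sum_i P de al * Q i l * _.
have E2 : \sum_al \sum_i (
    ((dP1 de al * Q i l + P de al * dQ1 i l) * (delta R al ga * delta R i k)
     - (dP2 de al * Q i l + P de al * dQ2 i l) * (delta R al be * delta R i j))
    + P de al * Q i l *
       structure_value u' t1' t2' f1' f2' o1' o2'
         (fun al i => delta R al be * delta R i j)
         (fun al i => delta R al ga * delta R i k) al i) =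
  dP1 de ga * Q k l + P de ga * dQ1 k l - (dP2 de be * Q j l + P de be * dQ2 j l)
  + (Q k l * (\sum_al P de al * t1' al ga) - Q j l * (\sum_al P de al * t2' al be)
     + (P de be * (\sum_i Q i l * f2' j i) - P de ga * (\sum_i Q i l * f1' k i))
     + (o1' * (P de ga * Q k l) - o2' * (P de be * Q j l)) + 2 * L).
  have e1 b m (t : 'I_p -> 'I_p -> R) : Q m l * (\sum_al P de al * t al b) =
      \sum_al \sum_i delta R i m * (P de al * Q i l * t al b).
    rewrite mulr_sumr; apply: eq_bigr => al _; rewrite sum_deltar; ring.
  have e2 b m (f : 'I_q -> 'I_q -> R) : P de b * (\sum_i Q i l * f m i) =
      \sum_al \sum_i delta R al b * (P de al * Q i l * f m i).
    rewrite exchange_big mulr_sumr; apply: eq_bigr => i _; rewrite sum_deltar; ring.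
  rewrite !e1 !e2 /L mulr_sumr.
  rewrite -(sum2_delta (fun al i => dP1 de al * Q i l + P de al * dQ1 i l) ga k).
  rewrite -(sum2_delta (fun al i => dP2 de al * Q i l + P de al * dQ2 i l) be j).
  rewrite -(sum2_delta (fun al i => P de al * Q i l) ga k).
  rewrite -(sum2_delta (fun al i => P de al * Q i l) be j).
  rewrite !(mulr_sumr, =^~ sumrB, =^~ big_split); apply: eq_bigr => al _.
  rewrite !(mulr_sumr, =^~ sumrB, =^~ big_split); apply: eq_bigr => i _.
  by rewrite /= structure_value_delta //; ring.
rewrite {}E2 in H; rewrite /fiber_q /fiber_p.
move: H; set r := \sum_be' _; set s1 := \sum_b _; set s2 := \sum_b _.
set s3 := \sum_i _; set s4 := \sum_i _; set s5 := \sum_al _; set s6 := \sum_al _.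
set s7 := \sum_i _; set s8 := \sum_i _ => H.
lra.
Qed.
End StructureComparison.

(** * Change of coframe and the tensor law *)

Section Covectors.
Variables (R : realType) (n : nat).
Implicit Types (r s v : 'rV[R]_n) (A B : 'M[R]_n).

Definition dot r v : R := \sum_a r 0 a * v 0 a.

Definition row_wedge r s : 'M[R]_n :=
  \matrix_(a, b) (r 0 a * s 0 b - r 0 b * s 0 a).

Definition eval2 A v1 v2 : R := \sum_a \sum_b v1 0 a * v2 0 b * A a b.

Lemma eval2D A B v1 v2 : eval2 (A + B) v1 v2 = eval2 A v1 v2 + eval2 B v1 v2.
Proof.
rewrite /eval2 -big_split; apply: eq_bigr => a _; rewrite -big_split.
by apply: eq_bigr => b _; rewrite mxE mulrDr.
Qed.

Lemma eval2Z (x : R) A v1 v2 : eval2 (x *: A) v1 v2 = x * eval2 A v1 v2.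
Proof.
rewrite /eval2 mulr_sumr; apply: eq_bigr => a _; rewrite mulr_sumr.
by apply: eq_bigr => b _; rewrite mxE mulrCA.
Qed.

Lemma eval2_sum (I : finType) (A : I -> 'M[R]_n) v1 v2 :
  eval2 (\sum_i A i) v1 v2 = \sum_i eval2 (A i) v1 v2.
Proof.
apply: (big_morph (fun A => eval2 A v1 v2)) => [B C|]; first exact: eval2D.
by rewrite /eval2 big1 // => a _; rewrite big1 // => b _; rewrite mxE mulr0.
Qed.

Lemma eval2_wedge r s v1 v2 :
  eval2 (row_wedge r s) v1 v2 = dot r v1 * dot s v2 - dot r v2 * dot s v1.
Proof.
rewrite /eval2 /dot [X in _ = _ - X]mulrC !mulr_suml -sumrB.
apply: eq_bigr => a _; rewrite !mulr_sumr -sumrB.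
by apply: eq_bigr => b _; rewrite mxE; ring.
Qed.

Lemma dot_sumr (I : finType) r (v : I -> 'rV[R]_n) :
  dot r (\sum_i v i) = \sum_i dot r (v i).
Proof.
by rewrite /dot exchange_big; apply: eq_bigr => a _; rewrite summxE mulr_sumr.
Qed.

Lemma dotZr r (x : R) v : dot r (x *: v) = x * dot r v.
Proof. by rewrite /dot mulr_sumr; apply: eq_bigr => a _; rewrite mxE mulrCA. Qed.

Lemma dot_linearl (x y : R) r s v :
  dot (x *: r + y *: s) v = x * dot r v + y * dot s v.
Proof.
rewrite /dot !mulr_sumr -big_split; apply: eq_bigr => a _.
by rewrite !mxE mulrDl !mulrA.
Qed.

End Covectors.

Section DualBases.
Variables (R : realType) (p q : nat).

(** Duality says W E^T = 1 for square matrices, whence E^T W = 1, which is the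
    expansion of covectors. *)
Lemma dual_expansion (w : 'I_p -> 'I_q -> 'rV[R]_(p * q))
    (e : 'I_q -> 'I_p -> 'rV[R]_(p * q)) (v : 'rV[R]_(p * q)) :
  (forall al i j be, dot (w al i) (e j be) = (al == be)%:R * (i == j)%:R) ->
  v = \sum_al \sum_i dot v (e i al) *: w al i.
Proof.
move=> we.
have [g gK' Kg'] := curry_mxvec_bij p q.
have gK : cancel (uncurry (@mxvec_index p q)) g by move=> s; exact: gK'.
have Kg : cancel g (uncurry (@mxvec_index p q)) by move=> k; exact: Kg'.
pose W := \matrix_k w (g k).1 (g k).2; pose E := \matrix_k e (g k).2 (g k).1.
have WE : W *m E^T = 1%:M.
  apply/matrixP => k l; rewrite !mxE.
  transitivity (dot (w (g k).1 (g k).2) (e (g l).2 (g l).1)).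
    by apply: eq_bigr => a _; rewrite !mxE.
  rewrite we -natrM mulnb; congr (_%:R); congr nat_of_bool.
  by rewrite -xpair_eqE -!surjective_pairing (can_eq Kg).
have EW := mulmx1C WE.
rewrite -[LHS]mulmx1 -EW mulmxA.
rewrite pair_bigA /= (reindex g) /=; last by exists (uncurry (@mxvec_index p q)) => s _.
apply/rowP => b; rewrite mxE summxE; apply: eq_bigr => k _.
rewrite !mxE; congr (_ * _).
by apply: eq_bigr => a _; rewrite !mxE.
Qed.

End DualBases.

Lemma tensor_law1 (R : realType) (p q : nat) (a a' : tensor R p q) :
  tensor_law 1%:M 1%:M a a' ->
  forall i be ga al j k, a i be ga al j k = a' i be ga al j k.
Proof.
move=> h i be ga al j k; have H := h i be ga al j k.
have dE m (s t : 'I_m) : (1%:M : 'M[R]_m) s t = delta R s t by rewrite mxE.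
transitivity (\sum_al' delta R al al' * \sum_i' delta R i' i * a' i' be ga al' j k);
  last by rewrite sum_deltal sum_deltar.
rewrite (_ : \sum_al' _ = \sum_(al' < p) \sum_(i' < q)
     1%:M al al' * 1%:M i' i * a' i' be ga al' j k); last first.
  apply: eq_bigr => al' _; rewrite mulr_sumr; apply: eq_bigr => i' _.
  by rewrite !dE mulrA.
rewrite {}H; transitivity (\sum_be' delta R be' be * \sum_ga' delta R ga' ga *
   \sum_j' delta R j j' * \sum_k' delta R k k' * a i be' ga' al j' k').
  by rewrite !sum_deltar !sum_deltal.
apply: eq_bigr => be' _; rewrite mulr_sumr; apply: eq_bigr => ga' _.
rewrite 2!mulr_sumr; apply: eq_bigr => j' _.
rewrite 3!mulr_sumr; apply: eq_bigr => k' _.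
by rewrite !dE; ring.
Qed.

Section TensorLaw.
Variables (R : realType) (p q : nat) (M : topologicalType).
Variable S : smooth_manifold R (p * q) M.
Notation field := (M -> components S).

Lemma structure_equation_eval (U : set M) (w : 'I_p -> 'I_q -> field) th ph om u
    (c : chart S) x al i (v1 v2 : 'rV[R]_(p * q)) :
  second_order_frame U w th ph om u -> U x -> dom c x ->
  eval2 (ext_d c (w al i) x) v1 v2 =
  structure_value (u x)
    (fun al be => dot (th al be x c) v1) (fun al be => dot (th al be x c) v2)
    (fun j i => dot (ph j i x c) v1) (fun j i => dot (ph j i x c) v2)
    (dot (om x c) v1) (dot (om x c) v2)
    (fun al i => dot (w al i x c) v1) (fun al i => dot (w al i x c) v2) al i.
Proof.
move=> h Ux cx; rewrite (sof_structure h Ux cx) !eval2D !eval2_sum.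
rewrite /structure_value; congr (_ + _ + _ + _).
- by apply: eq_bigr => be _; exact: eval2_wedge.
- apply: eq_bigr => j _; rewrite [wedge _ _ _ _]/(row_wedge _ _) eval2_wedge; ring.
- exact: eval2_wedge.
apply: eq_bigr => be _; rewrite eval2_sum; apply: eq_bigr => ga _.
rewrite eval2_sum; apply: eq_bigr => j _; rewrite eval2_sum; apply: eq_bigr => k _.
rewrite eval2Z [wedge _ _ _ _]/(row_wedge _ _) eval2_wedge; ring.
Qed.

(** The relation w = P Q w' is forced by duality from the relation between the
    frames. *)
Lemma coframe_change (U U' : set M) (e e' : 'I_q -> 'I_p -> field)
    (w w' : 'I_p -> 'I_q -> field) P Q x (c : chart S) :
  dual_coframe U e w -> dual_coframe U' e' w' ->
  frame_change (U `&` U') e e' P Q -> U x -> U' x -> dom c x ->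
  (forall de l j be, dot (w de l x c) (e' j be x c) = P x de be * Q x j l) /\
  (forall de l, w de l x c = \sum_al \sum_i (P x de al * Q x i l) *: w' al i x c).
Proof.
move=> ew ew' [_ _ _ ee'] Ux U'x cx.
have H de l j be : dot (w de l x c) (e' j be x c) = P x de be * Q x j l.
  rewrite (ee' x (conj Ux U'x)) dot_sumr.
  rewrite -(sum2_delta (fun al i => P x al be * Q x j i) de l).
  apply: eq_bigr => al _; rewrite dot_sumr; apply: eq_bigr => i _.
  rewrite dotZr; congr (_ * _).
  by rewrite -[LHS]/(pairing c _ _) (ew x c) // /delta ![_ == al]eq_sym ![_ == i]eq_sym.
split=> // de l; rewrite [LHS](dual_expansion _ (fun al i j be => ew' x c U'x cx al i j be)).
by apply: eq_bigr => al _; apply: eq_bigr => i _; rewrite H.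
Qed.

Lemma is_derive_bigsum (n : nat) (I : Type) (r : seq I) (h : I -> 'rV[R]_n -> R)
    (d : I -> R) (y v : 'rV[R]_n) : (forall i, is_derive y v (h i) (d i)) ->
  is_derive y v (fun z => \sum_(i <- r) h i z) (\sum_(i <- r) d i).
Proof.
move=> hd; elim: r => [|i r IH].
  have -> : (fun z => \sum_(i <- [::]) h i z) = cst 0.
    by apply/funext => z; rewrite big_nil.
  by rewrite big_nil; exact: is_derive_cst.
have -> : (fun z => \sum_(j <- i :: r) h j z) = h i \+ (fun z => \sum_(j <- r) h j z).
  by apply/funext => z; rewrite big_cons.
by rewrite big_cons; exact: is_deriveD.
Qed.

Definition differential (c : chart S) (f : M -> R) x : 'rV[R]_(p * q) :=
  \row_a partial a (fun y => f (param c y)) (Defs.coord c x).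

(** The Leibniz rule for w = P Q w', valid because that relation holds on a
    whole neighbourhood of the point. *)
Lemma ext_d_coframe (U U' : set M) (e e' : 'I_q -> 'I_p -> field)
    (w w' : 'I_p -> 'I_q -> field) P Q x (c : chart S) de l :
  open U -> open U' -> (forall al i, one_form U' (w' al i)) ->
  dual_coframe U e w -> dual_coframe U' e' w' ->
  frame_change (U `&` U') e e' P Q -> U x -> U' x -> dom c x ->
  ext_d c (w de l) x = \sum_al \sum_i
    (row_wedge (Q x i l *: differential c (fun x => P x de al) x
                + P x de al *: differential c (fun x => Q x i l) x) (w' al i x c)
     + (P x de al * Q x i l) *: ext_d c (w' al i) x).
Proof.
move=> oU oU' hw' ew ew' fc Ux U'x cx.
have [sP sQ _ _] := fc.
have oO := open_chart_image (c := c) (openI oU oU').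
set O := _ @` _ in oO.
have Oy : O (Defs.coord c x) by exists x.
have D a b : partial a (component c (w de l) b) (Defs.coord c x) =
  \sum_al \sum_i (
    (Q x i l * differential c (fun x => P x de al) x 0 a
     + P x de al * differential c (fun x => Q x i l) x 0 a) * w' al i x c 0 b
    + P x de al * Q x i l * partial a (component c (w' al i) b) (Defs.coord c x)).
  have E : {in O, component c (w de l) b =1 fun y => \sum_al \sum_i
      (P (param c y) de al * Q (param c y) i l) * component c (w' al i) b y}.
    move=> y; rewrite inE => -[z [cz [Uz U'z]] <-]; rewrite /component coordK //.
    have [_ ->] := coframe_change ew ew' fc Uz U'z cz.
    rewrite summxE; apply: eq_bigr => al _; rewrite summxE; apply: eq_bigr => i _.
    by rewrite mxE.
  rewrite (partial_eq a oO E) ?inE //.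
  have dP al : is_derive (Defs.coord c x) (delta_mx 0 a) (fun y => P (param c y) de al)
     (differential c (fun x => P x de al) x 0 a).
    rewrite mxE; apply: DeriveDef => //; exact: smooth_on_derivable (sP de al c) Oy.
  have dQ i : is_derive (Defs.coord c x) (delta_mx 0 a) (fun y => Q (param c y) i l)
     (differential c (fun x => Q x i l) x 0 a).
    rewrite mxE; apply: DeriveDef => //; exact: smooth_on_derivable (sQ i l c) Oy.
  have dw al i : is_derive (Defs.coord c x) (delta_mx 0 a) (component c (w' al i) b)
     (partial a (component c (w' al i) b) (Defs.coord c x)).
    apply: DeriveDef => //; have [_ sw'] := hw' al i.
    by apply: smooth_on_derivable (sw' c b) _; exists x.
  have := is_derive_bigsum (index_enum _) (fun al => is_derive_bigsum (index_enum _)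
     (fun i => is_deriveM (is_deriveM (dP al) (dQ i)) (dw al i))).
  move=> h; rewrite {1}/partial (@derive_val _ _ _ _ _ _ _ h).
  apply: eq_bigr => al _; apply: eq_bigr => i _.
  (* [is_deriveM] states the product rule with scalings instead of products. *)
  transitivity (P x de al * Q x i l
      * partial a (component c (w' al i) b) (Defs.coord c x)
    + w' al i x c 0 b *
      (P x de al * differential c (fun x => Q x i l) x 0 a
       + Q x i l * differential c (fun x => P x de al) x 0 a)); last by ring.
  by rewrite !fctE /= {2}/component coordK.
apply/matrixP => a b; rewrite mxE !D -sumrB summxE; apply: eq_bigr => al _.
rewrite -sumrB summxE; apply: eq_bigr => i _.
by rewrite !mxE; ring.
Qed.

(** Both sides of the differentiated relation w = P Q w' are evaluated on pairs
    of vectors of the frame e'. *)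
Lemma trace_free_tensor_law (U U' : set M) (e e' : 'I_q -> 'I_p -> field)
    (w w' : 'I_p -> 'I_q -> field) th ph om u th' ph' om' u' P Q x :
  open U -> open U' -> (forall al i, one_form U' (w' al i)) ->
  dual_coframe U e w -> dual_coframe U' e' w' ->
  second_order_frame U w th ph om u -> second_order_frame U' w' th' ph' om' u' ->
  frame_change (U `&` U') e e' P Q -> U x -> U' x ->
  trace_free (u x) -> trace_free (u' x) -> tensor_law (P x) (Q x) (u x) (u' x).
Proof.
move=> oU oU' hw' ew ew' hu hu' fc Ux U'x tu tu'.
have [c cx] := dom_cover S x.
have [_ _ /(_ x (conj Ux U'x))[uP uQ] _] := fc.
have [we' _] := coframe_change ew ew' fc Ux U'x cx.
pose E k ga := e' k ga x c.
pose dP k ga de al := dot (differential c (fun x => P x de al) x) (E k ga).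
pose dQ k ga i l := dot (differential c (fun x => Q x i l) x) (E k ga).
apply: (@tensor_lawP _ _ _ _ _ _ _
  (fun be ga de k => fiber_q (P x) (fun al be => dot (th al be x c) (E k ga))
     (fun al be => dot (th' al be x c) (E k ga))
     (dot (om x c) (E k ga)) (dot (om' x c) (E k ga)) (dP k ga) de be)
  (fun l ga j k => fiber_p (Q x) (fun j i => dot (ph j i x c) (E k ga))
     (fun j i => dot (ph' j i x c) (E k ga)) (dQ k ga) j l)) => //.
move=> l be ga de j k.
apply: structure_comparison;
  [exact: (sof_antisymmetric hu)|exact: (sof_antisymmetric hu')|].
have W'E j' be' : (fun al i => dot (w' al i x c) (E j' be')) =
    fun al i => delta R al be' * delta R i j'.
  by apply/funext => al; apply/funext => i; rewrite /E -[LHS]/(pairing c _ _) (ew' x c).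
have WE j' be' : (fun al i => dot (w al i x c) (E j' be')) =
    fun al i => P x al be' * Q x j' i.
  by apply/funext => al; apply/funext => i; rewrite /E we'.
have := structure_equation_eval de l (E j be) (E k ga) hu Ux cx.
rewrite !WE => <-.
rewrite (ext_d_coframe de l oU oU' hw' ew ew' fc Ux U'x cx) eval2_sum.
apply: eq_bigr => al _; rewrite eval2_sum; apply: eq_bigr => i _.
rewrite eval2D eval2Z (structure_equation_eval al i _ _ hu' U'x cx) !W'E.
congr (_ + _); rewrite eval2_wedge.
have dl v : dot (Q x i l *: differential c (fun x => P x de al) x
                + P x de al *: differential c (fun x => Q x i l) x) v =
  dot (differential c (fun x => P x de al) x) v * Q x i l
   + P x de al * dot (differential c (fun x => Q x i l) x) v.
  by rewrite dot_linearl mulrC.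
rewrite !dl -/(dP _ _ _ _) -/(dQ _ _ _ _).
have := W'E j be => /(congr1 (fun f => f al i)) /= ->.
have := W'E k ga => /(congr1 (fun f => f al i)) /= ->.
by [].
Qed.

End TensorLaw.

Theorem proposition3p3 (R : realType) (p q : nat) (M : topologicalType)
    (S : smooth_manifold R (p * q) M) (SC : M -> set (components S))
    (U : set M)
    (e : 'I_q -> 'I_p -> M -> components S)
    (w : 'I_p -> 'I_q -> M -> components S)
    (th : 'I_p -> 'I_p -> M -> components S)
    (ph : 'I_q -> 'I_q -> M -> components S)
    (om : M -> components S) (u : M -> tensor R p q)
    (hp : (2 <= p)%N) (hq : (2 <= q)%N)
    (hSC : almost_grassmann SC)
    (he : adapted_frame SC U e w)
    (hu : second_order_frame U w th ph om u) :
  (* a_tilde is a tensor *)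
  (forall (U' : set M)
      (e' : 'I_q -> 'I_p -> M -> components S)
      (w' : 'I_p -> 'I_q -> M -> components S)
      (th' : 'I_p -> 'I_p -> M -> components S)
      (ph' : 'I_q -> 'I_q -> M -> components S)
      (om' : M -> components S) (u' : M -> tensor R p q)
      (P : M -> 'M[R]_p) (Q : M -> 'M[R]_q),
      adapted_frame SC U' e' w' ->
      second_order_frame U' w' th' ph' om' u' ->
      frame_change (U `&` U') e e' P Q ->
      forall x, U x -> U' x ->
        tensor_law (P x) (Q x) (a_tilde (u x)) (a_tilde (u' x)))
  (* its symmetries *)
  /\ (forall x, U x ->
        trace_free (a_tilde (u x)) /\ antisymmetric_tensor (a_tilde (u x)))
  (* it is the torsion tensor *)
  /\ torsion_tensor U w (fun x => a_tilde (u x))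
  /\ (forall a : M -> tensor R p q, torsion_tensor U w a ->
        forall x, U x -> forall i be ga al j k,
          a_tilde (u x) i be ga al j k = a x i be ga al j k).
Proof.
have [oU _ hw ew _] := he.
have tu := normalized_second_order_frame oU hp hq hw hu.
have [th1 [ph1 [om1 [hu1 tf1]]]] := tu.
split; last split; last split=> //.
- move=> U' e' w' th' ph' om' u' P Q [oU' _ hw' ew' _] hu' fc x Ux U'x.
  have [th2 [ph2 [om2 [hu2 tf2]]]] := normalized_second_order_frame oU' hp hq hw' hu'.
  apply: (trace_free_tensor_law (u := fun x => a_tilde (u x))
    (u' := fun x => a_tilde (u' x)) oU oU' hw' ew ew' hu1 hu2 fc Ux U'x).
    exact: tf1.
  exact: tf2.
- move=> x Ux; split; first exact: tf1.
  exact: a_tilde_antisym (sof_antisymmetric hu Ux).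
move=> a [th2 [ph2 [om2 [hu2 tf2]]]] x Ux i be ga al j k.
have fc : frame_change (U `&` U) e e (fun=> 1%:M) (fun=> 1%:M).
  rewrite setIid; split=> [*|*|x' _|x' Ux' i' al' c].
  - exact: smooth_fun_cst.
  - exact: smooth_fun_cst.
  - by rewrite !unitmx1.
  rewrite (bigD1 al') //= [X in _ + X]big1 ?addr0 => [|be' /negPf be'al'].
    rewrite (bigD1 i') //= [X in _ + X]big1 ?addr0 => [|j' /negPf j'i'].
      by rewrite !mxE !eqxx mulr1 scale1r.
    by rewrite !mxE [i' == _]eq_sym j'i' mulr0 scale0r.
  by rewrite big1 // => j' _; rewrite !mxE be'al' mul0r scale0r.
have := trace_free_tensor_law (u := fun x => a_tilde (u x)) oU oU hw ew ew
   hu1 hu2 fc Ux Ux (tf1 x Ux) (tf2 x Ux).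
by move/tensor_law1 => ->.
Qed.
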